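(* Every smooth surface $\Sigma\subset\mathbb{L}(\mathbb{R}^3)=T\mathbb{S}^2$ of rank one on which the metric induced by the canonical neutral metric $\mathbb{G}$ is non-degenerate is marginally trapped, i.e. its mean curvature vector $\vec H$ satisfies $\mathbb{G}(\vec H,\vec H)=0$ at every point.
   Context: The space $\mathbb{L}(\mathbb{R}^3)$ of oriented lines in Euclidean 3-space is identified with $T\mathbb{S}^2$. Let $\xi$ be the holomorphic coordinate on $\mathbb{S}^2$ given by stereographic projection from the South pole onto the plane through the equator, and let $(\xi,\eta)$ be the induced canonical holomorphic coordinates on $T\mathbb{S}^2$, where $(\xi,\eta)$ stands for the tangent vector $\eta\,\partial/\partial\xi+\bar\eta\,\partial/\partial\bar\xi$ at $\xi$. The canonical neutral (signature $(2,2)$) metric is $$\mathbb{G}=\frac{2i}{(1+\xi\bar\xi)^2}\Big(d\eta\otimes d\bar\xi-d\bar\eta\otimes d\xi+\frac{2(\xi\bar\eta-\bar\xi\eta)}{1+\xi\bar\xi}\,d\xi\otimes d\bar\xi\Big),$$ where the products of one-forms are understood as symmetrised. The rank of a surface $\Sigma\subset T\mathbb{S}^2$ is the rank of the restriction to $\Sigma$ of the bundle projection $\pi:T\mathbb{S}^2\to\mathbb{S}^2$; rank one means that $d(\pi|_\Sigma)$ has rank one at every point. The surface is not assumed to be Lagrangian. A surface is marginally trapped if its mean curvature vector (the trace of the second fundamental form with respect to the induced metric) is null; the zero vector counts as null. *)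

(* Defs.v *)
From HB Require Import structures.
From mathcomp Require Import all_boot all_order all_algebra.
From mathcomp Require Import all_classical all_reals all_analysis.
From mathcomp Require Import complex ring.

Set Implicit Arguments.
Unset Strict Implicit.
Unset Printing Implicit Defensive.

Import Order.TTheory GRing.Theory Num.Theory.
Import numFieldNormedType.Exports.

Local Open Scope classical_set_scope.
Local Open Scope ring_scope.

Definition basis_vec (R : realType) (n : nat) (i : 'I_n.+1) : 'rV[R]_n.+1 :=
  delta_mx 0 i.

Definition pder (R : realType) (n : nat) (V : normedModType R) (i : 'I_n.+1)
  (f : 'rV[R]_n.+1 -> V) (x : 'rV[R]_n.+1) : V :=
  'D_(basis_vec R i) f x.

Fixpoint Ck (R : realType) (n : nat) (V : normedModType R) (k : nat)
  (U : set 'rV[R]_n.+1) (f : 'rV[R]_n.+1 -> V) {struct k} : Prop :=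
  match k with
  | 0%N => forall x, U x -> {for x, continuous f}
  | k'.+1 => (forall x, U x -> differentiable f x) /\
             (forall i, Ck k' U (pder i f))
  end.

Definition smooth_on (R : realType) (n : nat) (V : normedModType R)
  (U : set 'rV[R]_n.+1) (f : 'rV[R]_n.+1 -> V) : Prop :=
  forall k, Ck k U f.

(* A local parametrisation [(U, phi)] of a surface carried by [M]: the inverse
   of a coordinate chart.  The values of [phi] outside [U] are irrelevant. *)
Definition local_param (R : realType) (M : Type) : Type :=
  (set 'rV[R]_2 * ('rV[R]_2 -> M))%type.

(* [phi] is a homeomorphism of the open set [U] onto an open set of [M]. *)
Definition is_local_param (R : realType) (M : topologicalType)
  (c : local_param R M) : Prop :=
  [/\ open c.1,
      forall x, c.1 x -> {for x, continuous c.2},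
      {in c.1 &, injective c.2} &
      forall V, open V -> V `<=` c.1 -> open (c.2 @` V)].

(* [tau] is the coordinate change from [c] to [c'] on the overlap. *)
Definition smooth_transition (R : realType) (M : topologicalType)
  (c c' : local_param R M) : Prop :=
  let W := c.1 `&` c.2 @^-1` (c'.2 @` c'.1) in
  exists tau : 'rV[R]_2 -> 'rV[R]_2,
    smooth_on W tau /\ forall x, W x -> c'.1 (tau x) /\ c'.2 (tau x) = c.2 x.

Record smooth_surface (R : realType) : Type := SmoothSurface {
  carrier :> topologicalType;
  atlas : set (local_param R carrier);
  surface_hausdorff : hausdorff_space carrier;
  surface_countable : @second_countable carrier;
  atlas_param : forall c, atlas c -> is_local_param c;
  atlas_cover : forall p, exists2 c, atlas c & (c.2 @` c.1) p;
  atlas_smooth : forall c c', atlas c -> atlas c' -> smooth_transition c c'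
}.

(* T S^2 inside R^3 x R^3: the pair [(u, v)] is the tangent vector [v] at the
   unit vector [u], i.e. the oriented line of direction [u] through [v].  The
   bundle projection pi is [fst]. *)
Definition TS2 (R : realType) : set ('rV[R]_3 * 'rV[R]_3) :=
  [set p | (p.1 *m p.1^T) 0 0 = 1 /\ (p.1 *m p.2^T) 0 0 = 0].
Arguments TS2 : clear implicits.

(* Real and imaginary parts of xi = (u_1 + i u_2) / (1 + u_3). *)
Definition stereo (R : realType) (u : 'rV[R]_3) : 'rV[R]_2 :=
  \row_(j < 2) ((if j == 0 then u 0 0 else u 0 1) / (1 + u 0 2)).

(* (Re xi, Im xi, Re eta, Im eta): the tangent vector
   eta d/dxi + conj(eta) d/dconj(xi) is real with xi-component eta, so that
   eta = dxi(v). *)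
Definition south_chart (R : realType) (p : 'rV[R]_3 * 'rV[R]_3) : 'rV[R]_4 :=
  row_mx (stereo p.1) ('D_(p.2) (@stereo R) p.1) : 'rV[R]_(2 + 2).

(* Rotation by the angle pi about the first axis. *)
Definition rot (R : realType) (u : 'rV[R]_3) : 'rV[R]_3 :=
  \row_(j < 3) (if j == 0 then u 0 j else - u 0 j).

(* The coordinates [south_chart] miss the fibre over the South pole.  The
   second chart, [south_chart] after [rot], reads
   (xi', eta') = (1 / xi, - eta / xi^2) and misses the fibre over the North
   pole.  The coordinate expression of the neutral metric is the same in both
   charts, as [rot] is a Euclidean motion; this is how the metric is defined
   on the fibre over the South pole. *)
Definition ts2_chart (R : realType) (s : bool) (p : 'rV[R]_3 * 'rV[R]_3) :
  'rV[R]_4 :=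
  if s then south_chart p else south_chart (rot p.1, rot p.2).

Definition ts2_dom (R : realType) (s : bool) : set ('rV[R]_3 * 'rV[R]_3) :=
  [set p | TS2 R p /\
           (if s then 1 + p.1 0 2 != 0 else 1 + rot p.1 0 2 != 0)].

Section NeutralMetric.
Variable R : realType.

Definition xi_of (p : 'rV[R]_4) : R[i] := (p 0 0 +i* p 0 1)%C.
Definition eta_of (p : 'rV[R]_4) : R[i] := (p 0 2 +i* p 0 3)%C.

Definition sym_prod (a b : 'rV[R]_4 -> R[i]) (X Y : 'rV[R]_4) : R[i] :=
  (a X * b Y + a Y * b X) / 2.

(* The metric at the point with coordinates [p], on tangent vectors [X], [Y]
   given by their components in the same real coordinates.  The maps xi and
   eta are R-linear, hence [xi_of] also stands for dxi and [eta_of] for deta.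
   Conjugation and the imaginary unit are the concrete ones of [R[i]]. *)
Definition neutral_metricC (p X Y : 'rV[R]_4) : R[i] :=
  let xi := xi_of p in
  let eta := eta_of p in
  let xib := conjc xi in
  let etab := conjc eta in
  let dxi := xi_of in
  let deta := eta_of in
  let dxib := fun Z => conjc (xi_of Z) in
  let detab := fun Z => conjc (eta_of Z) in
  2 * 'i%C / (1 + xi * xib) ^+ 2 *
  (sym_prod deta dxib X Y - sym_prod detab dxi X Y
   + 2 * (xi * etab - xib * eta) / (1 + xi * xib) * sym_prod dxi dxib X Y).

Lemma neutral_metricC_real (p X Y : 'rV[R]_4) :
  complex.Im (neutral_metricC p X Y) = 0.
Proof.
have Im0 (z : R[i]) : conjc z = z -> complex.Im z = 0.
  case: z => a b /= [] /eqP; rewrite -subr_eq0 -opprD oppr_eq0 -mulr2n.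
  by rewrite mulrn_eq0 /= => /eqP.
have conji : conjc ('i%C : R[i]) = - 'i%C by simpc.
apply: Im0; rewrite /neutral_metricC /sym_prod.
move: (xi_of p) (eta_of p) (xi_of X) (eta_of X) (xi_of Y) (eta_of Y).
move=> z w zX wX zY wY; move: (Complex 0 1) conji => j conji.
have conjM (a b : R[i]) : conjc (a * b) = conjc a * conjc b by exact: rmorphM.
have conjD (a b : R[i]) : conjc (a + b) = conjc a + conjc b by exact: rmorphD.
have conjN (a : R[i]) : conjc (- a) = - conjc a by exact: rmorphN.
rewrite /= !expr2 !(conjM, conjD, conjN, conjc_inv, conjc1, conjc_nat).
rewrite !conjcK conji (mulrC (conjc z) z).
by ring.
Qed.

Definition neutral_metric (p X Y : 'rV[R]_4) : R :=
  complex.Re (neutral_metricC p X Y).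

End NeutralMetric.

Section ChartGeometry.
Variable R : realType.
Local Notation e := (@basis_vec R 3).

Definition metric_coef (i j : 'I_4) (p : 'rV[R]_4) : R :=
  neutral_metric p (e i) (e j).

Definition metric_mx (p : 'rV[R]_4) : 'M[R]_4 :=
  \matrix_(i, j) metric_coef i j p.

(* Gamma^k_ij of the Levi-Civita connection of the neutral metric. *)
Definition christoffel (p : 'rV[R]_4) (k i j : 'I_4) : R :=
  2^-1 * \sum_l invmx (metric_mx p) k l *
    (pder i (metric_coef j l : 'rV[R]_4 -> R^o) p
     + pder j (metric_coef i l : 'rV[R]_4 -> R^o) p
     - pder l (metric_coef i j : 'rV[R]_4 -> R^o) p).

(* In what follows [f] is a parametrised surface in coordinates of T S^2. *)
Variable f : 'rV[R]_2 -> 'rV[R]_4.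

Definition first_form (x : 'rV[R]_2) : 'M[R]_2 :=
  \matrix_(i, j) neutral_metric (f x) (pder i f x) (pder j f x).

(* nabla_{f_i} f_j *)
Definition cov_der (i j : 'I_2) (x : 'rV[R]_2) : 'rV[R]_4 :=
  pder i (pder j f) x +
  \row_k \sum_a \sum_b
    christoffel (f x) k a b * pder i f x 0 a * pder j f x 0 b.

Definition normal_part (x : 'rV[R]_2) (X : 'rV[R]_4) : 'rV[R]_4 :=
  X - \sum_i \sum_j
    (invmx (first_form x) i j * neutral_metric (f x) X (pder i f x))
      *: pder j f x.

Definition second_form (i j : 'I_2) (x : 'rV[R]_2) : 'rV[R]_4 :=
  normal_part x (cov_der i j x).

Definition mean_curvature (x : 'rV[R]_2) : 'rV[R]_4 :=
  \sum_i \sum_j invmx (first_form x) i j *: second_form i j x.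

End ChartGeometry.

Section SurfacesInTS2.
Variables (R : realType) (S : smooth_surface R).
Variable F : S -> 'rV[R]_3 * 'rV[R]_3.

(* [T S^2] is a submanifold of R^3 x R^3, so that smoothness and the rank of
   the differential may be read off in R^3 x R^3. *)
Definition immersed_in_TS2 : Prop :=
  (forall p, TS2 R (F p)) /\
  forall c, atlas c ->
    [/\ smooth_on c.1 (fst \o F \o c.2),
        smooth_on c.1 (snd \o F \o c.2) &
        forall x, c.1 x ->
          \rank (row_mx (jacobian (fst \o F \o c.2) x)
                        (jacobian (snd \o F \o c.2) x)) = 2%N].

Definition surface_rank_one : Prop :=
  forall c, atlas c -> forall x, c.1 x ->
    \rank (jacobian (fst \o F \o c.2) x) = 1%N.

Definition coord_expr (s : bool) (c : local_param R S) :
  'rV[R]_2 -> 'rV[R]_4 := @ts2_chart R s \o F \o c.2.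

Definition induced_nondegenerate : Prop :=
  forall c s, atlas c -> forall x, c.1 x -> ts2_dom s (F (c.2 x)) ->
    first_form (coord_expr s c) x \in unitmx.

Definition marginally_trapped : Prop :=
  forall c s, atlas c -> forall x, c.1 x -> ts2_dom s (F (c.2 x)) ->
    let f := coord_expr s c in
    neutral_metric (f x) (mean_curvature f x) (mean_curvature f x) = 0.

End SurfacesInTS2.

(* Main.v *)
Require Import Defs.
From HB Require Import structures.
From mathcomp Require Import all_boot all_order all_algebra.
From mathcomp Require Import all_classical all_reals all_analysis.
From mathcomp Require Import complex ring.

(* In a chart write f = (xi, eta), with xi valued in R^2.  Rank one means
   d_i xi = p_i z for a vector z and a covector p, both depending on the point.
   Differentiating det (d_0 xi, d_1 xi) = 0 and using the symmetry of second
   derivatives gives det (d_i d_j xi, z) = mu p_i p_j.  As the fibres are null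
   and the metric coefficients pairing base and fibre do not depend on eta, the
   Christoffel symbols with upper index in the base vanish as soon as one lower
   index is in the fibre; hence det (xi-part of nabla_i f_j, z) is again a
   multiple of p_i p_j.  The kernel of p is a null direction, so
   g^ij p_i p_j = 0 and the xi-part of the mean curvature vector H is a multiple
   of z.  Being orthogonal to the vertical tangent vector, H is then vertical
   by nondegeneracy, hence null. *)

Set Implicit Arguments.
Unset Strict Implicit.
Unset Printing Implicit Defensive.

Import Order.TTheory GRing.Theory Num.Theory.
Import numFieldNormedType.Exports.

Local Open Scope classical_set_scope.
Local Open Scope ring_scope.

(** * Partial derivatives *)

Section Calculus.
Variables (R : realType) (n : nat).
Local Notation rV := 'rV[R]_n.+1.
Implicit Types (f g : rV -> R) (U : set rV) (x v w : rV).

(** * Symmetry of mixed second derivatives, by second differences *)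

Lemma is_derive_line g x v (s : R) :
  derivable g (x + s *: v) v ->
  is_derive s 1 (fun t : R => g (x + t *: v)) ('D_v g (x + s *: v)).
Proof.
move=> dg.
have E : (fun h : R => h^-1 *: (((fun t : R => g (x + t *: v)) \o shift s)
            (h *: (1 : R)) - g (x + s *: v))) =
         (fun h : R => h^-1 *: ((g \o shift (x + s *: v)) (h *: v)
            - g (x + s *: v))).
  apply/funext => h /=; congr (_ *: (g _ - _)).
  by rewrite [h%:A]mulr1 scalerDl addrCA.
by split; rewrite /derivable /derive E.
Qed.

Lemma line_MVT g x v (h : R) : 0 < h ->
  (forall s, 0 <= s <= h -> derivable g (x + s *: v) v) ->
  exists2 s, 0 <= s <= h & g (x + h *: v) - g x = h * 'D_v g (x + s *: v).
Proof.
move=> h0 dg.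
have [s sh gs] : exists2 s, s \in `[0, h]%R &
    g (x + h *: v) - g (x + 0 *: v) = 'D_v g (x + s *: v) * (h - 0).
  apply: (@MVT_segment R (fun t => g (x + t *: v))
           (fun s => 'D_v g (x + s *: v)) 0 h (ltW h0)).
    move=> s; rewrite in_itv /= => /andP[s0 sh].
    by apply: is_derive_line; apply: dg; rewrite !ltW.
  apply: derivable_within_continuous => s; rewrite in_itv /= => sh.
  by have [] := is_derive_line (dg _ sh).
by exists s; [move: sh; rewrite in_itv|
  rewrite -[in LHS](addr0 x) -[X in g (x + X)](scale0r v) addr0 gs subr0 mulrC].
Qed.

Lemma is_derive_translate g x v w :
  derivable g (x + w) v ->
  is_derive x v (fun y => g (y + w)) ('D_v g (x + w)).
Proof.
move=> dg.
have E : (fun h : R => h^-1 *: (((fun y => g (y + w)) \o shift x) (h *: v)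
            - g (x + w))) =
         (fun h : R => h^-1 *: ((g \o shift (x + w)) (h *: v) - g (x + w))).
  by apply/funext => h /=; congr (_ *: (g _ - _)); rewrite addrA.
by split; rewrite /derivable /derive E.
Qed.

(** The mean value theorem twice: along [v] for the increment [g (y + h *: w) - g y], then along [w]
    for the derivative of [g] in direction [v], started at the point just found. *)
Lemma second_difference_MVT g x v w (h : R) : 0 < h ->
  (forall s t, 0 <= s <= h -> 0 <= t <= h ->
     derivable g (x + s *: v + t *: w) v) ->
  (forall s t, 0 <= s <= h -> 0 <= t <= h ->
     derivable (fun y => 'D_v g y) (x + s *: v + t *: w) w) ->
  exists s t, [/\ 0 <= s <= h, 0 <= t <= h &
    g (x + h *: v + h *: w) - g (x + h *: v) - (g (x + h *: w) - g x) =
    h * (h * 'D_w (fun y => 'D_v g y) (x + s *: v + t *: w))].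
Proof.
move=> h0 dv dw.
have hh : 0 <= h <= h by rewrite ltW /=.
have h00 : 0 <= (0 : R) <= h by rewrite lexx ltW.
have d1 s : 0 <= s <= h -> is_derive (x + s *: v) v (fun y => g (y + h *: w) - g y)
    ('D_v g (x + s *: v + h *: w) - 'D_v g (x + s *: v)).
  move=> sh; apply: is_deriveB; first by apply: is_derive_translate; exact: dv.
  by apply: derivableP; have := dv _ _ sh h00; rewrite scale0r addr0.
have [s sh E1] : exists2 s, 0 <= s <= h & _ :=
  line_MVT h0 (fun s sh => @ex_derive _ _ _ _ _ _ _ (d1 s sh)).
have [t th E2] : exists2 s, 0 <= s <= h & _ :=
  line_MVT h0 (fun t th => dw s t sh th).
exists s, t; split => //.
by rewrite -E2 E1; have [_ ->] := d1 s sh.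
Qed.

Lemma nbhs_ball_radius x (P : set rV) : nbhs x P ->
  exists2 r, 0 < r & forall y, `|x - y| < r -> P y.
Proof.
move=> /(@nbhs_ballP R rV) [r r0 rP]; exists r => // y xy.
by apply: rP; rewrite -ball_normE.
Qed.

Lemma parallelogram_bound x v w (s t h r : R) : 0 <= s <= h -> 0 <= t <= h ->
  h * (`|v| + `|w|) < r -> `|x - (x + s *: v + t *: w)| < r.
Proof.
move=> /andP[s0 sh] /andP[t0 th]; apply: le_lt_trans.
rewrite -addrA opprD addrA subrr add0r normrN.
apply: (le_trans (ler_normD _ _)); rewrite !normrZ !ger0_norm//.
by rewrite mulrDr lerD// ler_wpM2r.
Qed.

(** Some value of [A] equals some value of [B] at points arbitrarily close to [x], and continuity
    carries the equality to [x]. The vectors [v] and [w] come in opposite orders for [A] and [B], to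
    match the two orders of differentiation. *)
Lemma eq_of_near_eq_values (A B : rV -> R) x v w (r : R) : 0 < r ->
  {for x, continuous A} -> {for x, continuous B} ->
  (forall h, 0 < h -> h * (`|v| + `|w|) < r -> exists s t s' t',
    [/\ 0 <= s <= h, 0 <= t <= h, 0 <= s' <= h, 0 <= t' <= h &
        A (x + s *: v + t *: w) = B (x + s' *: w + t' *: v)]) ->
  A x = B x.
Proof.
move=> r0 cA cB AB; apply/eqP; rewrite -subr_eq0 -normr_le0.
apply/ler_addgt0Pl => e e0; rewrite addr0.
have e20 : 0 < e / 2 by rewrite divr_gt0.
have nA : nbhs x [set y | `|A x - A y| < e / 2] by move/cvgrPdist_lt : cA; apply.
have nB : nbhs x [set y | `|B x - B y| < e / 2] by move/cvgrPdist_lt : cB; apply.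
have [r' r'0 r'P] := nbhs_ball_radius (filterI nA nB).
(* The summand 1 keeps the denominator positive when [v] and [w] both vanish. *)
pose h := Num.min r r' / (`|v| + `|w| + 1).
have vw0 : 0 < `|v| + `|w| + 1 by rewrite ltr_wpDl// addr_ge0.
have m0 : 0 < Num.min r r' by rewrite lt_min r0.
have h0 : 0 < h by rewrite divr_gt0.
have hm : h * (`|v| + `|w|) < Num.min r r'.
  by rewrite /h -mulrA gtr_pMr// mulrC ltr_pdivrMr// mul1r ltrDl.
have [hr hr'] : h * (`|v| + `|w|) < r /\ h * (`|v| + `|w|) < r'.
  by move: hm; rewrite lt_min => /andP[].
have [s [t [s' [t' [sh th sh' th' E]]]]] := AB _ h0 hr.
have [/= nAs _] := r'P _ (parallelogram_bound x sh th hr').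
have hr'w : h * (`|w| + `|v|) < r' by rewrite (addrC `|w|).
have [/= _ nBs] := r'P _ (parallelogram_bound x sh' th' hr'w).
rewrite -(subrK (A (x + s *: v + t *: w)) (A x)) {2}E -addrA.
apply: (le_trans (ler_normD _ _)); rewrite (splitr e) lerD ?ltW//.
by rewrite distrC.
Qed.

(** The second difference is symmetric in [v] and [w]; evaluated in both orders, it gives equal
    values of the two mixed derivatives at points close to [x]. *)
Lemma derive_comm g U x v w : open U -> U x ->
  (forall y, U y -> derivable g y v /\ derivable g y w) ->
  (forall y, U y -> derivable (fun y => 'D_v g y) y w
                 /\ derivable (fun y => 'D_w g y) y v) ->
  {for x, continuous (fun y => 'D_w (fun y => 'D_v g y) y)} ->
  {for x, continuous (fun y => 'D_v (fun y => 'D_w g y) y)} ->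
  'D_w (fun y => 'D_v g y) x = 'D_v (fun y => 'D_w g y) x.
Proof.
move=> oU Ux d1 d2 c1 c2.
have [r r0 rU] := nbhs_ball_radius (open_nbhs_nbhs (conj oU Ux)).
apply: (eq_of_near_eq_values (v := v) (w := w) r0 c1 c2) => h h0 hr.
have hr' : h * (`|w| + `|v|) < r by rewrite (addrC `|w|).
have nearU s t (sh : 0 <= s <= h) (th : 0 <= t <= h) :=
  rU _ (parallelogram_bound x sh th hr).
have nearU' s t (sh : 0 <= s <= h) (th : 0 <= t <= h) :=
  rU _ (parallelogram_bound x sh th hr').
have [s [t [sh th E1]]] := second_difference_MVT h0
  (fun s t sh th => (d1 _ (nearU s t sh th)).1)
  (fun s t sh th => (d2 _ (nearU s t sh th)).1).
have [s' [t' [sh' th' E2]]] := second_difference_MVT h0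
  (fun s t sh th => (d1 _ (nearU' s t sh th)).2)
  (fun s t sh th => (d2 _ (nearU' s t sh th)).2).
exists s, t, s', t'; split; [exact: sh|exact: th|exact: sh'|exact: th'|].
have hn0 : h != 0 by rewrite gt_eqF.
apply: (mulfI hn0); apply: (mulfI hn0).
rewrite -[LHS]E1 -[RHS]E2 (addrAC x (h *: w)).
by move: (g _) (g _) (g _) (g _) => a b c d; ring.
Qed.

(* A variant of [Ck] with directional derivability instead of differentiability,
   so that the rules for products and quotients apply directly. *)
Fixpoint pCk (k : nat) U f {struct k} : Prop :=
  (forall x, U x -> {for x, continuous f}) /\
  match k with
  | 0%N => True
  | k'.+1 => (forall i x, U x -> derivable f x (basis_vec R i)) /\
             (forall i, pCk k' U (pder i (f : rV -> R^o)))
  end.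

Lemma pCk_cont k U f : pCk k U f -> forall x, U x -> {for x, continuous f}.
Proof. by case: k => [|k] []. Qed.

Lemma pCkW k U f : pCk k.+1 U f -> pCk k U f.
Proof.
elim: k f => [|k IH] f [cf [df pf]]; first by split.
by split => //; split => // i; exact: (IH _ (pf i)).
Qed.

Lemma pCk_sub k U U' f : U' `<=` U -> pCk k U f -> pCk k U' f.
Proof.
move=> sU; elim: k f => [|k IH] f [cf H]; (split; first by move=> x /sU /cf) => //.
by case: H => df pf; split => [i x /sU|i]; [exact: df|exact: (IH _ (pf i))].
Qed.

(** As [U] is open, equality on [U] is equality near each of its points, so limits and derivatives
    transfer. The closure lemmas below use this to replace a derivative by a formula valid on
    [U]. *)
Lemma pCk_ext k U f g : open U -> (forall x, U x -> f x = g x) ->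
  pCk k U f -> pCk k U g.
Proof.
move=> oU.
have nfg f' g' x : (forall x, U x -> f' x = g' x) -> U x -> {near x, f' =1 g'}.
  by move=> fg Ux; apply: filterS (open_nbhs_nbhs (conj oU Ux)) => y /fg.
have cfg f' g' : (forall x, U x -> f' x = g' x) ->
    (forall x, U x -> {for x, continuous f'}) ->
    forall x, U x -> {for x, continuous g'}.
  move=> fg cf x Ux; rewrite /prop_for /continuous_at -(fg _ Ux).
  exact: (cvg_trans (near_eq_cvg (nfg f' g' x fg Ux)) (cf _ Ux)).
elim: k f g => [|k IH] f g fg [cf H]; (split; first exact: cfg fg cf) => //.
case: H => df pf; split=> [i x Ux|i].
  exact: (near_eq_derivable (nfg _ _ _ fg Ux) (df i x Ux)).
apply: (IH (pder i (f : rV -> R^o)) _ _ (pf i)) => x Ux.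
exact: (near_eq_derive _ (nfg _ _ _ fg Ux)).
Qed.

Lemma pCk_cst k U (a : R) : open U -> pCk k U (fun=> a).
Proof.
move=> oU; elim: k a => [|k IH] a;
  (split; first by move=> x _; exact: cst_continuous) => //.
split=> [i x _|i]; first exact: derivable_cst.
by apply: (pCk_ext oU _ (IH 0)) => x _; rewrite /pder derive_cst.
Qed.

Lemma pCkD k U f g : open U -> pCk k U f -> pCk k U g ->
  pCk k U (fun x => f x + g x).
Proof.
move=> oU; elim: k f g => [|k IH] f g [cf Hf] [cg Hg];
  (split; first by move=> x Ux; apply: continuousD; [exact: cf|exact: cg]) => //.
case: Hf Hg => df pf [dg pg]; split=> [i x Ux|i].
  by apply: derivableD; [exact: df|exact: dg].
apply: (pCk_ext oU _ (IH _ _ (pf i) (pg i))) => x Ux.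
by rewrite /pder deriveD//; [exact: df|exact: dg].
Qed.

Lemma pCkM k U f g : open U -> pCk k U f -> pCk k U g ->
  pCk k U (fun x => f x * g x).
Proof.
move=> oU; elim: k f g => [|k IH] f g Hf Hg;
  (split; first by move=> x Ux; apply: continuousM;
     [exact: (pCk_cont Hf)|exact: (pCk_cont Hg)]) => //.
have [[_ [df pf]] [_ [dg pg]]] := (Hf, Hg); split=> [i x Ux|i].
  by apply: derivableM; [exact: df|exact: dg].
apply: (pCk_ext oU _ (pCkD oU (IH _ _ (pCkW Hf) (pg i))
  (IH _ _ (pCkW Hg) (pf i)))).
by move=> x Ux; rewrite /pder deriveM//; [exact: df|exact: dg].
Qed.

Lemma pCkN k U f : open U -> pCk k U f -> pCk k U (fun x => - f x).
Proof.
move=> oU Hf; apply: (pCk_ext oU _ (pCkM oU (pCk_cst k (-1) oU) Hf)).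
by move=> x _; rewrite mulN1r.
Qed.

(** Since (1/f)' = - (1/f)^2 f', the inductive step reduces to products. *)
Lemma pCkV k U f : open U -> (forall x, U x -> f x != 0) -> pCk k U f ->
  pCk k U (fun x => (f x)^-1).
Proof.
move=> oU f0; elim: k => [|k IH] Hf;
  (split; first by move=> x Ux; apply: continuousV;
     [exact: f0|exact: (pCk_cont Hf)]) => //.
have [_ [df pf]] := Hf; split=> [i x Ux|i].
  by apply: derivableV; [exact: f0|exact: df].
have If := IH (pCkW Hf).
apply: (pCk_ext oU _ (pCkN oU (pCkM oU (pCkM oU If If) (pf i)))) => x Ux.
rewrite /pder deriveV//; [|exact: f0|exact: df].
by rewrite /GRing.scale /= expr2 invfM mulNr.
Qed.

Lemma Ck_continuous m k U (f : rV -> 'rV[R]_m.+1) :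
  Ck k U f -> forall x, U x -> {for x, continuous f}.
Proof.
by case: k => [|k] // [df _] x Ux; apply: differentiable_continuous; exact: df.
Qed.

(** Passage from vector-valued smoothness to [pCk]: differentiability gives the directional
    derivatives, and these are taken coordinatewise. *)
Lemma Ck_coord m k U (f : rV -> 'rV[R]_m.+1) j : open U ->
  Ck k U f -> pCk k U (fun x => f x 0 j).
Proof.
move=> oU; elim: k f => [|k IH] f Hf; (split; first by move=> x Ux;
  exact: (continuous_comp (Ck_continuous Hf Ux) (@coord_continuous R 1 m.+1 0 j _)))
  => //.
case: Hf => df pf.
have ef i x : U x -> derivable f x (basis_vec R i).
  by move=> Ux; apply: diff_derivable; exact: df.
split=> [i x Ux|i]; first by have /derivable_mxP := ef i x Ux.
apply: (pCk_ext oU _ (IH _ (pf i))) => x Ux.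
by rewrite /pder derive_mx ?mxE//; exact: ef.
Qed.

Lemma pderC U g i j x : open U -> U x -> pCk 2 U g ->
  pder i (pder j (g : rV -> R^o)) x = pder j (pder i (g : rV -> R^o)) x.
Proof.
move=> oU Ux [_ [dg pg]].
have [[_ [dj cj]] [_ [di ci]]] := (pg j, pg i).
apply: (@derive_comm g U x (basis_vec R j) (basis_vec R i)) => //.
- by move=> y Uy; split; exact: dg.
- by move=> y Uy; split; [exact: dj|exact: di].
- exact: (cj i).1.
- exact: (ci j).1.
Qed.

Lemma pder_row m U (f : rV -> 'rV[R]_m.+1) i j x : open U -> U x ->
  (forall l, pCk 1 U (fun x => f x 0 l)) ->
  pder i f x 0 j = pder i (fun x => f x 0 j : R^o) x.
Proof.
move=> oU Ux df; rewrite /pder derive_mx ?mxE//.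
by apply/derivable_mxP => a b; rewrite (ord1 a); have [_ [+ _]] := df b; apply.
Qed.

Lemma pder2_row m U (f : rV -> 'rV[R]_m.+1) i j l x : open U -> U x ->
  (forall l, pCk 2 U (fun x => f x 0 l)) ->
  pder i (pder j f) x 0 l = pder i (pder j (fun x => f x 0 l : R^o)) x.
Proof.
move=> oU Ux df.
have pE y k : U y -> pder j f y 0 k = pder j (fun x => f x 0 k : R^o) y.
  by move=> Uy; apply: (pder_row _ _ oU Uy) => k'; exact: pCkW.
rewrite (pder_row _ _ oU Ux); last first.
  move=> k; have Hk : pCk 1 U (pder j (fun x => f x 0 k : R^o)) := (df k).2.2 j.
  by apply: (pCk_ext oU _ Hk) => y Uy; rewrite -pE.
apply: (near_eq_derive (V := rV) (W := R^o)).
by apply: filterS (open_nbhs_nbhs (conj oU Ux)) => y /pE.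
Qed.

End Calculus.

(** * The neutral metric *)

Lemma ord2_cases (i : 'I_2) : i = 0 \/ i = 1.
Proof. by case: i => [[|[|]]] // l2; [left|right]; apply/val_inj. Qed.

Lemma ord4_cases (l : 'I_4) : l = 0 \/ l = 1 \/ l = 2 \/ l = 3.
Proof.
by case: l => [[|[|[|[|]]]]] // l4; [left|right;left|do 2 right; left|do 3 right];
  apply/val_inj.
Qed.

Section Metric.
Variable R : realType.
Implicit Types p X Y : 'rV[R]_4.

Definition conf p : R := 1 + (p 0 0 ^+ 2 + p 0 1 ^+ 2).

Lemma conf_neq0 p : conf p != 0.
Proof. by rewrite gt_eqF// ltr_wpDr// addr_ge0// sqr_ge0. Qed.

(** In real coordinates, [fibre_coef] pairs base with fibre components and depends on xi only;
    [base_coef] multiplies the Euclidean product of the xi-components and is the only place where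
    eta enters the metric. *)
Definition fibre_coef p : R := - 2 / conf p ^+ 2.
Definition base_coef p : R :=
  8 * (p 0 0 * p 0 3 - p 0 1 * p 0 2) / conf p ^+ 3.

Lemma fibre_coef_neq0 p : fibre_coef p != 0.
Proof.
rewrite mulf_neq0 ?oppr_eq0 ?pnatr_eq0// invr_eq0 expf_neq0//.
exact: conf_neq0.
Qed.

Lemma neutral_metricE p X Y : neutral_metric p X Y =
  fibre_coef p * (X 0 3 * Y 0 0 - X 0 2 * Y 0 1 + Y 0 3 * X 0 0 - Y 0 2 * X 0 1)
  + base_coef p * (X 0 0 * Y 0 0 + X 0 1 * Y 0 1).
Proof.
have w0 := conf_neq0 p.
(* The denominators are real, so the complex expression can be expanded into real and imaginary
   parts. *)
have wE : 1 + xi_of p * conjc (xi_of p) = (conf p)%:C%C.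
  rewrite /xi_of /conf; move: (p 0 0) (p 0 1) => a b; simpc.
  by congr Complex; ring.
have twoE : 2 = (2 : R)%:C%C by rewrite rmorph_nat.
have iE : 'i%C * 'i%C = (-1)%:C%C :> R[i] by simpc.
rewrite /neutral_metric /neutral_metricC; cbv zeta beta.
rewrite wE /sym_prod /fibre_coef /base_coef.
rewrite twoE -!rmorphXn -!fmorphV /xi_of /eta_of.
move: (p 0 0) (p 0 1) (p 0 2) (p 0 3) (conf p) w0 => a b c d v v0.
move: (X 0 0) (X 0 1) (X 0 2) (X 0 3) => x0 x1 x2 x3.
move: (Y 0 0) (Y 0 1) (Y 0 2) (Y 0 3) => y0 y1 y2 y3.
simpc.
by rewrite /=; field.
Qed.


Lemma neutral_metric_sym p X Y : neutral_metric p X Y = neutral_metric p Y X.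
Proof. by rewrite !neutral_metricE; ring. Qed.

Lemma neutral_metricDl p X X' Y :
  neutral_metric p (X + X') Y = neutral_metric p X Y + neutral_metric p X' Y.
Proof. by rewrite !neutral_metricE !mxE; ring. Qed.

Lemma neutral_metricZl p a X Y :
  neutral_metric p (a *: X) Y = a * neutral_metric p X Y.
Proof. by rewrite !neutral_metricE !mxE; ring. Qed.

Lemma neutral_metric_suml p (I : finType) (X : I -> 'rV[R]_4) Y :
  neutral_metric p (\sum_i X i) Y = \sum_i neutral_metric p (X i) Y.
Proof.
apply: (big_morph (fun Z => neutral_metric p Z Y)) => [Z Z'|].
  exact: neutral_metricDl.
by rewrite neutral_metricE !mxE; ring.
Qed.

Lemma basis_vec_fibre (a : 'I_4) : (2 <= a)%N ->
  basis_vec R a 0 0 = 0 /\ basis_vec R a 0 1 = 0.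
Proof. by rewrite /basis_vec !mxE; case: a => [[|[|[|[|a]]]]] //=. Qed.

Lemma metric_coefC (a b : 'I_4) p : metric_coef a b p = metric_coef b a p.
Proof. exact: neutral_metric_sym. Qed.

Lemma metric_coef_fibre (a b : 'I_4) p : (2 <= a)%N -> (2 <= b)%N ->
  metric_coef a b p = 0.
Proof.
move=> /basis_vec_fibre[a0 a1] /basis_vec_fibre[b0 b1].
by rewrite /metric_coef neutral_metricE a0 a1 b0 b1; ring.
Qed.

(** With a fibre index, only [fibre_coef] occurs, and a vertical shift leaves xi unchanged. *)
Lemma metric_coef_fibre_shift (a b l : 'I_4) p (h : R) :
  (2 <= a)%N -> (2 <= l)%N ->
  metric_coef a b (h *: basis_vec R l + p) = metric_coef a b p.
Proof.
move=> /basis_vec_fibre[a0 a1] /basis_vec_fibre[l0 l1].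
rewrite /metric_coef !neutral_metricE a0 a1 !(mul0r, addr0, mulr0).
have E j : basis_vec R l 0 j = 0 -> (h *: basis_vec R l + p) 0 j = p 0 j.
  by move=> lj; rewrite !mxE in lj *; rewrite lj mulr0 add0r.
by rewrite /fibre_coef /conf !E.
Qed.

Lemma derive_eq0 n (f : 'rV[R]_n -> R^o) x v :
  (forall h : R, f (h *: v + x) = f x) -> 'D_v f x = 0.
Proof.
move=> fv; rewrite /derive; apply: cvg_lim => //.
rewrite (_ : (fun h : R => _) = fun=> (0 : R^o)); first exact: cvg_cst.
by apply/funext => h /=; rewrite fv subrr scaler0.
Qed.

(** Either both indices are vertical and the coefficient is identically zero, or the derivative is
    vertical and a coefficient with a fibre index does not see eta. *)
Lemma pder_metric_coef_fibre (a b l : 'I_4) p :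
  (2 <= a)%N -> (2 <= b)%N || (2 <= l)%N ->
  pder l (metric_coef a b : 'rV[R]_4 -> R^o) p = 0 /\
  pder l (metric_coef b a : 'rV[R]_4 -> R^o) p = 0.
Proof.
move=> a2 bl; have E h : metric_coef a b (h *: basis_vec R l + p) = metric_coef a b p.
  case/orP: bl => [b2|l2]; first by rewrite !metric_coef_fibre.
  exact: metric_coef_fibre_shift.
by split; apply: derive_eq0 => h //; rewrite !(metric_coefC b).
Qed.

(** The last two entries see only the base part of [v], as the fibres are null. Both the
    invertibility of the metric and the zero block of its inverse follow from this. *)
Lemma mul_metric_mx p (v : 'rV[R]_4) (u := v *m metric_mx p) :
  [/\ u 0 0 = v 0 0 * base_coef p + v 0 3 * fibre_coef p,
      u 0 1 = v 0 1 * base_coef p - v 0 2 * fibre_coef p,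
      u 0 2 = - (v 0 1 * fibre_coef p) & u 0 3 = v 0 0 * fibre_coef p].
Proof.
have i1 : lift ord0 ord0 = 1 :> 'I_4 by apply/val_inj.
have i2 : lift ord0 (lift ord0 ord0) = 2 :> 'I_4 by apply/val_inj.
have i3 : lift ord0 (lift ord0 (lift ord0 ord0)) = 3 :> 'I_4 by apply/val_inj.
rewrite /u !mxE !big_ord_recl !big_ord0 !mxE.
rewrite /metric_coef !neutral_metricE /basis_vec !mxE /= i1 i2 i3.
by split; ring.
Qed.

Lemma metric_mx_unit p : metric_mx p \in unitmx.
Proof.
rewrite unitmxE unitfE; apply/negP => /det0P[v v0 vM].
have c0 := fibre_coef_neq0 p.
have [] := mul_metric_mx p v; rewrite vM !mxE => e0 e1 e2 e3.
have v00 : v 0 0 = 0 by apply: (mulIf c0); rewrite -e3 mul0r.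
have v01 : v 0 1 = 0 by apply: (mulIf c0); rewrite -[LHS]opprK -e2 mul0r oppr0.
have v03 : v 0 3 = 0 by apply: (mulIf c0); move: e0; rewrite v00 !mul0r add0r.
have v02 : v 0 2 = 0.
  apply: (mulIf c0); rewrite -[LHS]opprK; move: e1.
  by rewrite v01 !mul0r add0r => <-; rewrite oppr0.
move: v0; apply/negP; rewrite negbK; apply/eqP/rowP => j; rewrite [RHS]mxE.
by have [|[|[|]]] := ord4_cases j => ->.
Qed.

(* The fibres are null, so the dual metric vanishes on the pull-backs of
   covectors of the base. *)
Lemma invmx_metric_mx_base p (k l : 'I_4) : (k < 2)%N -> (l < 2)%N ->
  invmx (metric_mx p) k l = 0.
Proof.
move=> k2 l2; have c0 := fibre_coef_neq0 p.
have [_ _ e2 e3] := mul_metric_mx p (row k (invmx (metric_mx p))).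
move: e2 e3; rewrite -row_mul (mulVmx (metric_mx_unit p)) !mxE.
have -> : (k == 2) = false by case: k k2 => [[|[|]]].
have -> : (k == 3) = false by case: k k2 => [[|[|]]].
move=> e2 e3.
have v0 : invmx (metric_mx p) k 0 = 0 by apply: (mulIf c0); rewrite -e3 mul0r.
have v1 : invmx (metric_mx p) k 1 = 0.
  by apply: (mulIf c0); rewrite -[LHS]opprK -e2 mul0r oppr0.
case: l l2 => [[|[|l]]] //= l4 _.
- by rewrite -v0; congr (invmx _ _ _); apply/val_inj.
- by rewrite -v1; congr (invmx _ _ _); apply/val_inj.
Qed.

(** In the sum over [l], base indices are killed by the inverse metric; for a fibre index [l], each
    of the three derivatives vanishes. *)
Lemma christoffel_base_fibre p (k i j : 'I_4) :
  (k < 2)%N -> (2 <= i)%N || (2 <= j)%N -> christoffel p k i j = 0.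
Proof.
move=> k2 ij; rewrite /christoffel big1 ?mulr0// => l _.
have [l2|l2] := ltnP l 2; first by rewrite invmx_metric_mx_base// mul0r.
have [ji _] := @pder_metric_coef_fibre l j i p l2 ltac:(by rewrite orbC).
have [ij' _] := @pder_metric_coef_fibre l i j p l2 ij.
have lij : pder l (metric_coef i j : 'rV[R]_4 -> R^o) p = 0.
  case/orP: ij => i2.
    by have [] := @pder_metric_coef_fibre i j l p i2 ltac:(by rewrite l2 orbT).
  by have [] := @pder_metric_coef_fibre j i l p i2 ltac:(by rewrite l2 orbT).
have C a b : metric_coef a b = metric_coef b a :> ('rV[R]_4 -> R).
  by apply/funext => q; exact: metric_coefC.
by rewrite (C j l) (C i l) ji ij' lij; ring.
Qed.

End Metric.

(** * Planes meeting the fibre in a line *)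

Lemma rank1_factor (K : fieldType) m n (A : 'M[K]_(m, n)) : \rank A = 1%N ->
  exists (c : 'cV[K]_m) (r : 'rV[K]_n), A = c *m r.
Proof.
move=> rk; have := mulmx_base A; move: (col_base A) (row_base A).
by rewrite rk => c r <-; exists c, r.
Qed.

(** If the first row is nonzero, it serves as [z], and division by one of its nonzero entries gives
    [p]; otherwise [z] is the second row and [p] is (0, 1). *)
Lemma minor0_factor (K : fieldType) (a : 'I_2 -> 'I_2 -> K) :
  a 0 0 * a 1 1 = a 0 1 * a 1 0 ->
  exists p z : 'I_2 -> K, forall i k, a i k = p i * z k.
Proof.
move=> ad.
suff [p0 [p1 [z0 [z1 [e00 e01 e10 e11]]]]] : exists p0 p1 z0 z1 : K,
    [/\ a 0 0 = p0 * z0, a 0 1 = p0 * z1, a 1 0 = p1 * z0 & a 1 1 = p1 * z1].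
  exists (fun i => if i == 0 then p0 else p1), (fun k => if k == 0 then z0 else z1).
  by move=> i k; case: (ord2_cases i) => ->; case: (ord2_cases k) => ->.
have [a00|a00] := eqVneq (a 0 0) 0; last first.
  exists 1, (a 1 0 / a 0 0), (a 0 0), (a 0 1); split; rewrite ?mul1r ?divfK//.
  by rewrite mulrAC mulrC -[a 1 0 * _]mulrC -ad mulrA mulVf// mul1r.
have [a01|a01] := eqVneq (a 0 1) 0; last first.
  exists 1, (a 1 1 / a 0 1), (a 0 0), (a 0 1); split; rewrite ?mul1r ?divfK//.
  by apply: (mulfI a01); rewrite -ad a00 !mul0r !mulr0.
by exists 0, 1, (a 1 0), (a 1 1); split; rewrite ?mul0r ?mul1r.
Qed.

Lemma det2 (K : comNzRingType) (A : 'M[K]_2) :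
  \det A = A 0 0 * A 1 1 - A 0 1 * A 1 0.
Proof.
rewrite (expand_det_row _ 0) !big_ord_recl big_ord0 /cofactor !det_mx11 !mxE /=.
have -> : lift ord0 ord0 = 1 :> 'I_2 by apply/val_inj.
have -> : lift 1 0 = 0 :> 'I_2 by apply/val_inj.
have -> : ord0 = 0 :> 'I_2 by apply/val_inj.
by rewrite /bump /= expr0 expr1; ring.
Qed.

Lemma sum_delta (K : nzRingType) n (F : 'I_n -> K) (k : 'I_n) :
  \sum_i F i * (1%:M : 'M[K]_n) i k = F k.
Proof.
rewrite (bigD1 k)//= mxE eqxx mulr1 big1 ?addr0// => i ik.
by rewrite mxE (negbTE ik) mulr0.
Qed.

(* For [u i] the partial derivatives of a surface and [h i j] their covariant
   derivatives, [normal_trace h] is the mean curvature vector. *)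
Section RankOnePlane.
Variables (R : realType) (q : 'rV[R]_4) (u : 'I_2 -> 'rV[R]_4).
Local Notation G := (neutral_metric q).

Definition gram : 'M[R]_2 := \matrix_(i, j) G (u i) (u j).
Local Notation N := (invmx gram).

Definition normal_proj (X : 'rV[R]_4) : 'rV[R]_4 :=
  X - \sum_i \sum_j (N i j * G X (u i)) *: u j.

Definition normal_trace (h : 'I_2 -> 'I_2 -> 'rV[R]_4) : 'rV[R]_4 :=
  \sum_i \sum_j N i j *: normal_proj (h i j).

Hypothesis g_unit : gram \in unitmx.

Local Opaque neutral_metric.

Lemma neutral_metric_normal_proj X k : G (normal_proj X) (u k) = 0.
Proof.
rewrite /normal_proj -scaleN1r neutral_metricDl neutral_metricZl mulN1r.
rewrite neutral_metric_suml; apply/eqP; rewrite subr_eq0; apply/eqP.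
transitivity (\sum_i G X (u i) * (N *m gram) i k).
  by rewrite (mulVmx g_unit) sum_delta.
apply: eq_bigr => i _; rewrite neutral_metric_suml mxE mulr_sumr.
by apply: eq_bigr => j _; rewrite neutral_metricZl mxE mulrCA mulrA.
Qed.

Lemma neutral_metric_normal_trace h k : G (normal_trace h) (u k) = 0.
Proof.
rewrite /normal_trace neutral_metric_suml big1// => i _.
rewrite neutral_metric_suml big1// => j _.
by rewrite neutral_metricZl neutral_metric_normal_proj mulr0.
Qed.

Variables p z : 'I_2 -> R.
Hypotheses (u0 : forall i, u i 0 0 = p i * z 0)
           (u1 : forall i, u i 0 1 = p i * z 1).

(** The pairing of the vertical part of [u i] with the vector of base part [z] and fibre part 0. *)
Let y i := fibre_coef q * (u i 0 3 * z 0 - u i 0 2 * z 1).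

Lemma first_form_rank1 : exists b, forall i j,
  gram i j = y i * p j + y j * p i + b * p i * p j.
Proof.
exists (base_coef q * (z 0 ^+ 2 + z 1 ^+ 2)) => i j.
by rewrite mxE neutral_metricE !u0 !u1 /y; ring.
Qed.

(** The determinant of the Gram matrix is minus the square of this quantity; the coefficient [b]
    cancels. *)
Lemma transverse_neq0 : y 1 * p 0 - y 0 * p 1 != 0.
Proof.
have [b gE] := first_form_rank1.
move: g_unit; rewrite unitmxE unitfE; apply: contraNneq => s0.
rewrite det2 !gE.
rewrite (_ : _ - _ = - (y 1 * p 0 - y 0 * p 1) ^+ 2); first by rewrite s0 expr0n oppr0.
by ring.
Qed.

(** The Gram matrix maps the kernel vector w = (- p_1, p_0) of [p] to s p, where s = y_1 p_0 - y_0
    p_1 is nonzero. Hence w = s N p, and pairing with [p] gives zero. *)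
Lemma conormal_null : \sum_i \sum_j N i j * p i * p j = 0.
Proof.
have [b gE] := first_form_rank1; have s0 := transverse_neq0.
have l1 : lift ord0 ord0 = 1 :> 'I_2 by apply/val_inj.
have Ng k l : N k 0 * gram 0 l + N k 1 * gram 1 l = (k == l)%:R.
  have /matrixP/(_ k l) := mulVmx g_unit.
  rewrite mxE [in RHS]mxE !big_ord_recl big_ord0 addr0 l1 => <-.
  by congr (N k _ * gram _ l + _); apply/val_inj.
have V k : (k == 1)%:R * p 0 - (k == 0)%:R * p 1 =
   (y 1 * p 0 - y 0 * p 1) * (N k 0 * p 0 + N k 1 * p 1).
  by rewrite -!Ng !gE; ring.
rewrite !big_ord_recl !big_ord0 l1.
apply: (mulfI s0); rewrite mulr0.
transitivity ((y 1 * p 0 - y 0 * p 1) * (N 0 0 * p 0 + N 0 1 * p 1) * p 0 +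
  (y 1 * p 0 - y 0 * p 1) * (N 1 0 * p 0 + N 1 1 * p 1) * p 1); first by ring.
by rewrite -!V /=; ring.
Qed.

Lemma base_null (X : 'rV[R]_4) : (forall k, G X (u k) = 0) ->
  X 0 0 * z 1 = X 0 1 * z 0 -> G X X = 0.
Proof.
move=> GX Xz; have s0 := transverse_neq0; have c0 := fibre_coef_neq0 q.
(* The vertical tangent vector p_0 u_1 - p_1 u_0. Orthogonality to it and proportionality to [z] are
   two linear equations for the base part of [X], whose determinant is nonzero by transversality. So
   [X] is vertical, hence null. *)
pose V k := u 1 0 k * p 0 - u 0 0 k * p 1.
have XV : X 0 0 * V 3 = X 0 1 * V 2.
  apply: (mulfI c0); apply/eqP; rewrite -subr_eq0; apply/eqP.
  transitivity (p 0 * G X (u 1) - p 1 * G X (u 0)); last by rewrite !GX; ring.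
  by rewrite !neutral_metricE !u0 !u1 /V; ring.
have zV : z 0 * V 3 - z 1 * V 2 != 0.
  apply: contraNneq s0 => zV; apply/eqP.
  transitivity (fibre_coef q * (z 0 * V 3 - z 1 * V 2)); last by rewrite zV mulr0.
  by rewrite /y /V; ring.
have X0 : X 0 0 = 0.
  apply: (mulIf zV); rewrite mul0r.
  transitivity (z 0 * (X 0 0 * V 3) - (X 0 0 * z 1) * V 2); first by ring.
  by rewrite XV Xz; ring.
have X1 : X 0 1 = 0.
  apply: (mulIf zV); rewrite mul0r.
  transitivity ((X 0 1 * z 0) * V 3 - z 1 * (X 0 1 * V 2)); first by ring.
  by rewrite -XV -Xz; ring.
by rewrite neutral_metricE X0 X1; ring.
Qed.


Lemma normal_trace_null (h : 'I_2 -> 'I_2 -> 'rV[R]_4) mu :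
  (forall i j, h i j 0 0 * z 1 - h i j 0 1 * z 0 = mu * p i * p j) ->
  G (normal_trace h) (normal_trace h) = 0.
Proof.
move=> hE; apply: base_null; first exact: neutral_metric_normal_trace.
(* The linear form [L] kills the tangent vectors [u k], so it does not see the normal projection; on
   the trace it gives mu times the sum in [conormal_null]. *)
pose L (X : 'rV[R]_4) := X 0 0 * z 1 - X 0 1 * z 0.
have LZ a X : L (a *: X) = a * L X by rewrite /L !mxE; ring.
have LD : {morph L : X Y / X + Y >-> X + Y} by move=> X Y; rewrite /L !mxE; ring.
have L0 : L 0 = 0 by rewrite /L !mxE; ring.
have Lu k : L (u k) = 0 by rewrite /L u0 u1; ring.
apply/eqP; rewrite -subr_eq0; apply/eqP; rewrite -/(L (normal_trace h)).
transitivity (\sum_i \sum_j mu * (N i j * p i * p j)); last first.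
  under eq_bigr do rewrite -mulr_sumr.
  by rewrite -mulr_sumr conormal_null mulr0.
rewrite /normal_trace (big_morph L LD L0); apply: eq_bigr => i _.
rewrite (big_morph L LD L0); apply: eq_bigr => j _.
rewrite LZ /normal_proj -scaleN1r LD LZ (big_morph L LD L0) big1.
  by rewrite mulr0 addr0 {1}/L hE; ring.
move=> k _; rewrite (big_morph L LD L0) big1// => l _.
by rewrite LZ Lu mulr0.
Qed.

Variable d : 'I_2 -> 'I_2 -> R.
Hypotheses (d_sym : d 0 1 = d 1 0)
           (d_minor : forall k, p 1 * d k 0 = p 0 * d k 1).

(** By [d_minor] each row of [d] is a multiple of [p], and by symmetry so is each column.
    Transversality makes [p] nonzero, and [mu] is read off a diagonal entry. *)
Lemma second_derivative_rank1 : exists mu, forall i j, d i j = mu * p i * p j.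
Proof.
have [p0|p0] := eqVneq (p 0) 0.
  have p1 : p 1 != 0.
    by apply: contraNneq transverse_neq0 => p1; rewrite p0 p1; apply/eqP; ring.
  have dk k : d k 0 = 0 by apply: (mulfI p1); rewrite d_minor p0 mulr0 mul0r.
  exists (d 1 1 / p 1 ^+ 2) => i j.
  case: (ord2_cases i) => ->; case: (ord2_cases j) => ->.
  - by rewrite dk p0; ring.
  - by rewrite d_sym dk p0; ring.
  - by rewrite dk p0; ring.
  - by field.
exists (d 0 0 / p 0 ^+ 2).
have dk k : d k 1 = p 1 * d k 0 / p 0 by rewrite d_minor mulrC mulKf.
move=> i j; case: (ord2_cases i) => ->; case: (ord2_cases j) => ->.
- by field.
- by rewrite dk; field.
- by rewrite -d_sym dk; field.
- by rewrite dk -d_sym dk; field.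
Qed.

(** Only base indices [a] and [b] contribute, and there [u i] is [p i] times [z]; so [K] is the
    Christoffel form evaluated on [z] twice. *)
Lemma christoffel_rank1 (k : 'I_4) : (k < 2)%N -> exists K, forall i j,
  \sum_a \sum_b christoffel q k a b * u i 0 a * u j 0 b = K * p i * p j.
Proof.
move=> k2.
have C (a b : 'I_4) : (2 <= a)%N || (2 <= b)%N -> christoffel q k a b = 0.
  exact: christoffel_base_fibre.
exists (christoffel q k 0 0 * z 0 * z 0 + christoffel q k 0 1 * z 0 * z 1
  + christoffel q k 1 0 * z 1 * z 0 + christoffel q k 1 1 * z 1 * z 1) => i j.
move: (christoffel q k) C => c C.
have l1 n : lift ord0 ord0 = 1 :> 'I_n.+2 by apply/val_inj.
have Cl (a : 'I_2) b : c (lift ord0 (lift ord0 a)) b = 0 by exact: C.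
have Cr a (b : 'I_2) : c a (lift ord0 (lift ord0 b)) = 0.
  by apply: C; rewrite orbT.
rewrite !big_ord_recl !big_ord0 !(Cl, Cr) !(mul0r, addr0) !l1.
have -> : ord0 = 0 :> 'I_4 by apply/val_inj.
by rewrite !u0 !u1; ring.
Qed.

End RankOnePlane.

(** * Surfaces of rank one in a chart *)

Section RankOneChart.
Variable R : realType.
Local Notation D i h := (pder i (h : 'rV[R]_2 -> R^o)).

Lemma pder_minor (U : set 'rV[R]_2) (a b : 'rV[R]_2 -> R) x k :
  open U -> U x -> pCk 2 U a -> pCk 2 U b ->
  (forall y, U y -> D 0 a y * D 1 b y = D 0 b y * D 1 a y) ->
  D 0 a x * D k (D 1 b) x + D 1 b x * D k (D 0 a) x =
  D 0 b x * D k (D 1 a) x + D 1 a x * D k (D 0 b) x.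
Proof.
move=> oU Ux [_ [_ da]] [_ [_ db]] ab.
have dM (g h : 'rV[R]_2 -> R) : pCk 1 U g -> pCk 1 U h ->
    D k (fun y => g y * h y) x = g x * D k h x + h x * D k g x.
  move=> [_ [dg _]] [_ [dh _]].
  exact: (@deriveM _ _ g h x _ (dg k x Ux) (dh k x Ux)).
transitivity (D k (fun y => D 0 a y * D 1 b y) x).
  exact: (esym (dM _ _ (da 0) (db 1))).
transitivity (D k (fun y => D 0 b y * D 1 a y) x); last first.
  exact: (dM _ _ (db 0) (da 1)).
apply: (near_eq_derive (V := 'rV[R]_2) (W := R^o)).
by apply: filterS (open_nbhs_nbhs (conj oU Ux)) => y /ab.
Qed.

Lemma mean_curvature_null (U : set 'rV[R]_2) (f : 'rV[R]_2 -> 'rV[R]_4) x :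
  open U -> U x -> (forall l, pCk 2 U (fun y => f y 0 l)) ->
  (forall y, U y -> D 0 (fun y => f y 0 0) y * D 1 (fun y => f y 0 1) y =
                    D 0 (fun y => f y 0 1) y * D 1 (fun y => f y 0 0) y) ->
  first_form f x \in unitmx ->
  neutral_metric (f x) (mean_curvature f x) (mean_curvature f x) = 0.
Proof.
move=> oU Ux df minor g_unit.
have df1 i l : pder i f x 0 l = D i (fun y => f y 0 l) x.
  by apply: (pder_row _ _ oU Ux) => l'; exact: pCkW.
have df2 i j l : pder i (pder j f) x 0 l = D i (D j (fun y => f y 0 l)) x.
  exact: (pder2_row _ _ _ oU Ux).
(* The differential of xi at [x]. It is factored at this point only; near [x] it is the identity
   between minors that gets differentiated. *)
pose a (i k : 'I_2) : R :=
  if k == 0 then D i (fun y => f y 0 0) x else D i (fun y => f y 0 1) x.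
have [p [z aE]] : exists p z : 'I_2 -> R, forall i k, a i k = p i * z k.
  by apply: minor0_factor; exact: minor.
have u0 i : pder i f x 0 0 = p i * z 0 by rewrite df1 -[LHS]/(a i 0) aE.
have u1 i : pder i f x 0 1 = p i * z 1 by rewrite df1 -[LHS]/(a i 1) aE.
(* The determinant of the second derivative of xi with the fixed vector [z]. *)
pose d k j : R := D k (D j (fun y => f y 0 0)) x * z 1
   - D k (D j (fun y => f y 0 1)) x * z 0.
have d_sym : d 0 1 = d 1 0.
  by rewrite /d !(pderC 0 1 oU Ux (df _)).
have d_minor k : p 1 * d k 0 = p 0 * d k 1.
  have aux (p0 p1 z0 z1 s t s' t' : R) :
      p0 * z0 * t' + p1 * z1 * s' = p0 * z1 * t + p1 * z0 * s ->
      p1 * (s' * z1 - s * z0) = p0 * (t * z1 - t' * z0).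
    move=> E; apply/eqP; rewrite -subr_eq0; apply/eqP.
    transitivity (p0 * z0 * t' + p1 * z1 * s' - (p0 * z1 * t + p1 * z0 * s)).
      by ring.
    by rewrite E subrr.
  have E := pder_minor k oU Ux (df 0) (df 1) minor.
  have e0 i : D i (fun y => f y 0 0) x = p i * z 0 by rewrite -df1 u0.
  have e1 i : D i (fun y => f y 0 1) x = p i * z 1 by rewrite -df1 u1.
  rewrite (e0 0) (e1 0) (e0 1) (e1 1) in E.
  exact: aux E.
pose u i := pder i f x; have g_unit' : gram (f x) u \in unitmx by exact: g_unit.
have [mu dE] := second_derivative_rank1 g_unit' u0 u1 d_sym d_minor.
have [K0 K0E] := @christoffel_rank1 _ (f x) u p z u0 u1 0 isT.
have [K1 K1E] := @christoffel_rank1 _ (f x) u p z u0 u1 1 isT.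
(* By unfolding, [mean_curvature] is the [normal_trace] of the covariant derivatives. Their
   determinant with [z] collects [d] and the two Christoffel terms of base upper index. *)
apply: (@normal_trace_null _ (f x) u g_unit' p z u0 u1
  (fun i j => cov_der f i j x) (mu + K0 * z 1 - K1 * z 0)) => i j.
rewrite !mxE K0E K1E !df2.
transitivity (d i j + (K0 * z 1 - K1 * z 0) * p i * p j); last first.
  by rewrite dE; ring.
rewrite /d; move: (D i _ x) (D i _ x) => s t.
by ring.
Qed.

End RankOneChart.

(** * The coordinates of an oriented line *)

Section Charts.
Variable R : realType.

Lemma derivable_coord n (x v : 'rV[R]_n.+1) j :
  derivable (fun u : 'rV[R]_n.+1 => u 0 j : R^o) x v.
Proof. by have /derivable_mxP := @derivable_id _ _ x v; apply. Qed.

Lemma derive_coord n (x v : 'rV[R]_n.+1) j :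
  'D_v (fun u : 'rV[R]_n.+1 => u 0 j : R^o) x = v 0 j.
Proof.
by rewrite -[in RHS](@derive_id _ _ x v) derive_mx ?mxE//; exact: derivable_id.
Qed.

Lemma derive_quotient (V : normedModType R) (a b : V -> R) x v :
  b x != 0 -> derivable a x v -> derivable b x v ->
  is_derive x v (fun y => a y / b y) ('D_v a x / b x - a x * 'D_v b x / b x ^+ 2).
Proof.
move=> b0 da db; have dbV := derivableV b0 db.
split; first exact: (derivableM da dbV).
rewrite (deriveM da dbV) (deriveV b0 db) /GRing.scale /=.
by move: ('D_v a x) ('D_v b x) => s t; field.
Qed.

(** The last two entries are dxi(v), by the quotient rule in the ambient space. *)
Lemma south_chartE (p : 'rV[R]_3 * 'rV[R]_3) : 1 + p.1 0 2 != 0 ->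
  [/\ south_chart p 0 0 = p.1 0 0 / (1 + p.1 0 2),
      south_chart p 0 1 = p.1 0 1 / (1 + p.1 0 2),
      south_chart p 0 2 = p.2 0 0 / (1 + p.1 0 2)
                        - p.1 0 0 * p.2 0 2 / (1 + p.1 0 2) ^+ 2 &
      south_chart p 0 3 = p.2 0 1 / (1 + p.1 0 2)
                        - p.1 0 1 * p.2 0 2 / (1 + p.1 0 2) ^+ 2].
Proof.
case: p => u v /= u0.
have b_der : is_derive u v (fun w : 'rV[R]_3 => 1 + w 0 2) (v 0 2).
  split; first by apply: derivableD; [exact: derivable_cst|exact: derivable_coord].
  rewrite deriveD ?derive_cst ?add0r ?derive_coord//; exact: derivable_coord.
have q_der k : is_derive u v (fun w : 'rV[R]_3 => w 0 k / (1 + w 0 2))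
    (v 0 k / (1 + u 0 2) - u 0 k * v 0 2 / (1 + u 0 2) ^+ 2).
  have [db bE] := b_der.
  have := @derive_quotient 'rV[R]_3 (fun w => w 0 k) (fun w => 1 + w 0 2) u v
    u0 (@derivable_coord _ u v k) db.
  by rewrite (@derive_coord _ u v k) bE.
have sE (j : 'I_2) w : stereo w 0 j = w 0 (if j == 0 then 0 else 1) / (1 + w 0 2).
  by rewrite mxE; case: ifP.
have dsE (j : 'I_2) (k := if j == 0 then 0 else 1 : 'I_3) :
    'D_v (@stereo R) u 0 j = v 0 k / (1 + u 0 2) - u 0 k * v 0 2 / (1 + u 0 2) ^+ 2.
  have sj i l : (fun w => stereo w i l) =
      (fun w : 'rV[R]_3 => w 0 (if l == 0 then 0 else 1) / (1 + w 0 2)).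
    by apply/funext => w; rewrite (ord1 i) sE.
  rewrite derive_mx.
    by rewrite mxE sj; have [_ ->] := q_der k.
  by apply/derivable_mxP => i l; rewrite sj; have [] := q_der (if l == 0 then 0 else 1).
have e0 : 0 = lshift 2 (0 : 'I_2) :> 'I_4 by apply/val_inj.
have e1 : 1 = lshift 2 (1 : 'I_2) :> 'I_4 by apply/val_inj.
have e2 : 2 = rshift 2 (0 : 'I_2) :> 'I_4 by apply/val_inj.
have e3 : 3 = rshift 2 (1 : 'I_2) :> 'I_4 by apply/val_inj.
have El j := row_mxEl (stereo u) ('D_v (@stereo R) u) 0 j.
have Er j := row_mxEr (stereo u) ('D_v (@stereo R) u) 0 j.
rewrite /south_chart /=; split.
- by rewrite e0 [LHS]El sE.
- by rewrite e1 [LHS]El sE.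
- by rewrite e2 [LHS]Er dsE.
- by rewrite e3 [LHS]Er dsE.
Qed.

Local Notation D i h := (pder i (h : 'rV[R]_2 -> R^o)).

(** Stereographic projection does not raise the rank: with w = 1 + a_2, and [A] and [B] the two
    partial derivatives, the minor of xi is a combination of the minors of the direction vector. *)
Lemma quotient_minor (a0 a1 A0 A1 A2 B0 B1 B2 w : R) : w != 0 ->
  A0 * B1 = A1 * B0 -> A0 * B2 = A2 * B0 -> A1 * B2 = A2 * B1 ->
  (A0 / w - a0 * A2 / w ^+ 2) * (B1 / w - a1 * B2 / w ^+ 2) =
  (A1 / w - a1 * A2 / w ^+ 2) * (B0 / w - a0 * B2 / w ^+ 2).
Proof.
move=> w0 m01 m02 m12; apply/eqP; rewrite -subr_eq0; apply/eqP.
transitivity ((A0 * B1 - A1 * B0) / w ^+ 2 - a1 * (A0 * B2 - A2 * B0) / w ^+ 3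
  + a0 * (A1 * B2 - A2 * B1) / w ^+ 3); first by field.
by rewrite m01 m02 m12 !subrr; ring.
Qed.

(** Stated for arbitrary component functions, so that it serves both charts. *)
Lemma south_chart_trapped (U : set 'rV[R]_2) (a b : 'I_3 -> 'rV[R]_2 -> R)
    (P : 'rV[R]_2 -> 'rV[R]_3 * 'rV[R]_3) x (f := @south_chart R \o P) :
  (forall y j, (P y).1 0 j = a j y) -> (forall y j, (P y).2 0 j = b j y) ->
  open U -> U x -> (forall j, pCk 2 U (a j)) -> (forall j, pCk 2 U (b j)) ->
  (forall j k y, U y -> D 0 (a j) y * D 1 (a k) y = D 0 (a k) y * D 1 (a j) y) ->
  1 + a 2 x != 0 -> first_form f x \in unitmx ->
  neutral_metric (f x) (mean_curvature f x) (mean_curvature f x) = 0.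
Proof.
move=> Pa Pb oU Ux da db minor x0 g_unit.
pose c y := 1 + a 2 y.
have dc : pCk 2 U c by exact: (pCkD oU (pCk_cst 2 1 oU) (da 2)).
(* The open part of [U] mapped into the domain of the chart; the formulas for [f] are used only
   there. *)
pose W := [set y | U y /\ c y != 0].
have oW : open W.
  rewrite openE => y [Uy cy]; change (nbhs y W).
  have nc : nbhs y [set t | c t != 0].
    exact: (cvgr_neq0 (c y) (pCk_cont dc Uy) cy).
  have nU : nbhs y U by exact: open_nbhs_nbhs.
  exact: (filterI nU nc).
have sWU : W `<=` U by move=> y [].
have Wx : W x by split.
have {}da j := pCk_sub sWU (da j).
have {}db j := pCk_sub sWU (db j).
have {}dc := pCk_sub sWU dc.
have dcV : pCk 2 W (fun y => (c y)^-1) by apply: (pCkV oW _ dc) => y [].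
have fE y : W y -> [/\ f y 0 0 = a 0 y / c y, f y 0 1 = a 1 y / c y,
    f y 0 2 = b 0 y / c y - a 0 y * b 2 y / c y ^+ 2 &
    f y 0 3 = b 1 y / c y - a 1 y * b 2 y / c y ^+ 2].
  move=> [_ cy]; have cP : 1 + (P y).1 0 2 = c y by rewrite Pa.
  have := @south_chartE (P y); rewrite cP => /(_ cy).
  by rewrite !Pa !Pb.
have dq j : pCk 2 W (fun y => a j y / c y) by exact: (pCkM oW (da j) dcV).
have dr j : pCk 2 W (fun y => b j y / c y - a j y * b 2 y / c y ^+ 2).
  apply: (pCk_ext oW _ (pCkD oW (pCkM oW (db j) dcV)
    (pCkN oW (pCkM oW (pCkM oW (da j) (db 2)) (pCkM oW dcV dcV))))) => y _.
  by rewrite expr2 invfM.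
have df (l : 'I_4) : pCk 2 W (fun y => f y 0 l).
  have [|[|[|]]] := ord4_cases l => ->.
  - by apply: (pCk_ext oW _ (dq 0)) => y /fE[].
  - by apply: (pCk_ext oW _ (dq 1)) => y /fE[].
  - by apply: (pCk_ext oW _ (dr 0)) => y /fE[].
  - by apply: (pCk_ext oW _ (dr 1)) => y /fE[].
have Dq i j y : W y -> D i (fun y => a j y / c y) y =
    D i (a j) y / c y - a j y * D i (a 2) y / c y ^+ 2.
  move=> Wy; have [Uy cy] := Wy.
  have [_ [daj _]] := da j; have [_ [da2 _]] := da 2; have [_ [dc1 _]] := dc.
  have [_ qE] := @derive_quotient 'rV[R]_2 (a j) c y (basis_vec R i) cy
    (daj i y Wy) (dc1 i y Wy).
  have cE : 'D_(basis_vec R i) c y = D i (a 2) y.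
    have d1 : derivable (cst 1 : 'rV[R]_2 -> R^o) y (basis_vec R i).
      exact: derivable_cst.
    have := deriveD d1 (da2 i y Wy).
    by rewrite derive_cst add0r.
  by rewrite [LHS]qE cE.
apply: (mean_curvature_null oW Wx df) => // y Wy.
have nW : nbhs y W := open_nbhs_nbhs (conj oW Wy).
have D0 i : D i (fun y => f y 0 0) y = D i (fun y => a 0 y / c y) y.
  apply: (near_eq_derive (V := 'rV[R]_2) (W := R^o)).
  by apply: filterS nW => t /fE[].
have D1 i : D i (fun y => f y 0 1) y = D i (fun y => a 1 y / c y) y.
  apply: (near_eq_derive (V := 'rV[R]_2) (W := R^o)).
  by apply: filterS nW => t /fE[].
have [Uy cy] := Wy.
rewrite (D0 0) (D1 0) (D0 1) (D1 1) !(Dq _ _ _ Wy).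
exact: (quotient_minor _ _ cy (minor 0 1 y Uy) (minor 0 2 y Uy) (minor 1 2 y Uy)).
Qed.

End Charts.

(** * From the surface to its coordinate expressions *)

Lemma jacobian_rank1_minor (R : realType) n m (u : 'rV[R]_n.+1 -> 'rV[R]_m.+1)
    (y : 'rV[R]_n.+1) i1 i2 j k :
  differentiable u y -> \rank (jacobian u y) = 1%N ->
  pder i1 (fun t => u t 0 j : R^o) y * pder i2 (fun t => u t 0 k : R^o) y =
  pder i1 (fun t => u t 0 k : R^o) y * pder i2 (fun t => u t 0 j : R^o) y.
Proof.
move=> du rk.
have E i l : pder i (fun t => u t 0 l : R^o) y = jacobian u y i l.
  have := deriveEjacobian (basis_vec R i) du.
  rewrite derive_mx; last exact: diff_derivable.
  by move=> /rowP/(_ l); rewrite -rowE !mxE.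
(* The Jacobian is a column times a row, so its minors of order two vanish. *)
have [v [w Jvw]] := rank1_factor rk.
by rewrite !E Jvw !mxE !big_ord1; ring.
Qed.

Theorem theorem2 (R : realType) (S : smooth_surface R)
  (F : S -> 'rV[R]_3 * 'rV[R]_3)
  (immF : immersed_in_TS2 F)
  (rankF : surface_rank_one F)
  (ndF : induced_nondegenerate F) :
  marginally_trapped F.
Proof.
move=> c s ac x cx [tx dom] f.
have [oU _ _ _] := atlas_param ac.
have [sm1 sm2 _] := immF.2 c ac.
pose u := fst \o F \o c.2; pose v := snd \o F \o c.2.
(* The two charts differ by [rot], which only changes signs of components; so either one is
   [south_chart] after a map [P] with components [sgn j] times those of [F]. *)
pose sgn (j : 'I_3) : R := if s || (j == 0) then 1 else -1.
pose P y := if s then F (c.2 y) else (Defs.rot (F (c.2 y)).1, Defs.rot (F (c.2 y)).2).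
have fE : f = @south_chart R \o P.
  by apply/funext => y; rewrite /f /coord_expr /P /ts2_chart /=; case: (s).
have P1 y j : (P y).1 0 j = sgn j * u y 0 j.
  rewrite /P /sgn; case: (s) => /=; first by rewrite mul1r.
  by rewrite mxE; case: ifP; rewrite ?mul1r ?mulN1r.
have P2 y j : (P y).2 0 j = sgn j * v y 0 j.
  rewrite /P /sgn; case: (s) => /=; first by rewrite mul1r.
  by rewrite mxE; case: ifP; rewrite ?mul1r ?mulN1r.
have Du j : pCk 2 c.1 (fun y => u y 0 j) := Ck_coord j oU (sm1 2).
have Dv j : pCk 2 c.1 (fun y => v y 0 j) := Ck_coord j oU (sm2 2).
have g_unit : first_form f x \in unitmx by exact: (ndF c s ac x cx (conj tx dom)).
rewrite fE in g_unit *.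
apply: (south_chart_trapped P1 P2 oU cx _ _ _ _ g_unit).
- by move=> j; exact: (pCkM oU (pCk_cst 2 (sgn j) oU) (Du j)).
- by move=> j; exact: (pCkM oU (pCk_cst 2 (sgn j) oU) (Dv j)).
- move=> j k y Uy.
  have pE i l : pder i (fun t => sgn l * u t 0 l : R^o) y =
      sgn l * pder i (fun t => u t 0 l : R^o) y.
    have [_ [du _]] := Du l.
    exact: (deriveZ (sgn l) (du i y Uy)).
  (* Both sides carry the same factor [sgn j * sgn k]. *)
  rewrite !pE mulrACA [RHS]mulrACA (mulrC (sgn k)).
  by rewrite (jacobian_rank1_minor 0 1 j k ((sm1 1%N).1 y Uy) (rankF c ac y Uy)).
- by rewrite -P1 /P; move: dom; case: (s).
Qed.
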